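(* Let $p$ be a prime with $p \equiv 3 \pmod 4$ and let $t$ be a primitive root modulo $p$. Then the semidirect product $\mathbb{Z}_p \rtimes_\phi \mathbb{Z}_{p-1}$ is a DDP group, where $\phi: \mathbb{Z}_{p-1} \rightarrow \mathrm{Aut}(\mathbb{Z}_p)$ is given by $\phi_s(x)=t^{2s}x$. In particular, there exist infinitely many (pairwise non-isomorphic) non-abelian DDP groups.
   Context: $\mathbb{Z}_n=\mathbb{Z}/n\mathbb{Z}$ denotes the additive cyclic group of order $n$. The semidirect product $\mathbb{Z}_m\rtimes_\phi\mathbb{Z}_n$ is the set $\mathbb{Z}_m\times\mathbb{Z}_n$ with multiplication $(r,s)(r',s')=(r+\phi_s(r'),\,s+s')$. A finite group $G$ of order $n$ is a DDP group if there is a permutation $g_0,\ldots,g_{n-1}$ of the elements of $G$ (each element listed exactly once) such that $g_0=1_G$ and $g_i^{-1}g_{i+1}\neq g_j^{-1}g_{j+1}$ for all $0\le i<j<n-1$. *)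

(* Defs.v *)
From HB Require Import structures.
From mathcomp Require Import all_boot all_order all_algebra all_fingroup.

Set Implicit Arguments.
Unset Strict Implicit.
Unset Printing Implicit Defensive.

Import GRing.Theory.

Definition DDP (gT : finGroupType) : Prop :=
  exists g : seq gT,
    [/\ perm_eq g (enum gT),
        nth 1%g g 0 = 1%g
      & forall i j : nat, i < j -> j < #|gT|.-1 ->
          ((nth 1 g i)^-1 * nth 1 g i.+1
             <> (nth 1 g j)^-1 * nth 1 g j.+1)%g].

(* Morphisms Z_n -> Aut(Z_m).  The moduli must be at least 2, since 'Z_0 and
   'Z_1 denote Z/2Z.  Composition in {perm _} is in diagrammatic order, but as
   Z_n is commutative a morphism is the same thing for either order. *)
Notation Zaut_morphism m n :=
  {morphism [set: 'Z_n] >-> [subg (Aut [set: 'Z_m])]}.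

Definition Zact (m n : nat) (phi : Zaut_morphism m n) (s : 'Z_n) (x : 'Z_m)
  : 'Z_m := sgval (phi s) x.

(* The library's sdprod_by uses (s, r) (s', r') = (s + s', to r s' + r')
   instead; here the acting factor is on the right and acts on the left. *)
Record Zsdprod (m n : nat) (phi : Zaut_morphism m n) : Type :=
  ZSdPair { Zsd_pair : 'Z_m * 'Z_n }.
Coercion Zsd_pair : Zsdprod >-> prod.

HB.instance Definition _ m n (phi : Zaut_morphism m n) :=
  [isNew for (@Zsd_pair m n phi)].
HB.instance Definition _ m n (phi : Zaut_morphism m n) :=
  [Finite of Zsdprod phi by <:].

Section ZsdprodGroup.
Local Open Scope ring_scope.
Variables (m n : nat) (phi : Zaut_morphism m n).

Definition Zsdprod_mul (u v : Zsdprod phi) : Zsdprod phi :=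
  ZSdPair phi (u.1 + Zact phi u.2 v.1, u.2 + v.2).
Definition Zsdprod_one : Zsdprod phi := ZSdPair phi (0, 0).
Definition Zsdprod_inv (u : Zsdprod phi) : Zsdprod phi :=
  ZSdPair phi (- Zact phi (- u.2) u.1, - u.2).

Lemma ZactD s : {morph Zact phi s : x y / x + y}.
Proof.
move=> x y; have sA := subgP (phi s).
by have := morphM (autm_morphism sA) (in_setT x) (in_setT y).
Qed.

Lemma Zact0 x : Zact phi 0 x = x.
Proof. by have:= morph1 phi; rewrite /Zact => ->; rewrite perm1. Qed.

Lemma Zact_add s s' x : Zact phi (s + s') x = Zact phi s (Zact phi s' x).
Proof.
have:= morphM phi (in_setT s') (in_setT s); rewrite /Zact addrC => ->.
by rewrite permM.
Qed.

Lemma Zsdprod_mulA : associative Zsdprod_mul.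
Proof.
move=> [[r s]] [[r' s']] [[r2 s2]]; rewrite /Zsdprod_mul /=.
by rewrite ZactD Zact_add !addrA.
Qed.

Lemma Zsdprod_mul1 : left_id Zsdprod_one Zsdprod_mul.
Proof. by case=> [[r s]]; rewrite /Zsdprod_mul /= Zact0 !add0r. Qed.

Lemma Zsdprod_mulV : left_inverse Zsdprod_one Zsdprod_inv Zsdprod_mul.
Proof. by case=> [[r s]]; rewrite /Zsdprod_mul /= !addNr. Qed.

HB.instance Definition _ := Finite_isGroup.Build (Zsdprod phi)
  Zsdprod_mulA Zsdprod_mul1 Zsdprod_mulV.

End ZsdprodGroup.

(* t is a primitive root modulo p: its residue class has multiplicative
   order p - 1 (for p prime). *)
Definition primitive_root_mod (p : nat) (t : int) : bool :=
  (p.-1.-primitive_root (t%:~R : 'Z_p))%R.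

Section SquareAction.
Local Open Scope ring_scope.
Variables (p : nat) (t : int).
Hypotheses (p_gt2 : (2 < p)%N) (t_prim : primitive_root_mod p t).

Definition sq_act (s : 'Z_p.-1) (x : 'Z_p) : 'Z_p := t%:~R ^+ (2 * s) * x.

Let tV : (t%:~R : 'Z_p) ^+ p.-1 = 1.
Proof. exact: prim_expr_order t_prim. Qed.

Let tU : (t%:~R : 'Z_p) \is a GRing.unit.
Proof.
by rewrite -(@unitrX_pos _ _ p.-1) ?tV ?unitr1 //; case: (p) p_gt2 => [|[]].
Qed.

Lemma sq_act_inj s : injective (sq_act s).
Proof. by apply: mulrI; rewrite unitrX. Qed.

Definition sq_perm s : {perm 'Z_p} := perm (@sq_act_inj s).

Lemma sq_perm_Aut s : sq_perm s \in Aut [set: 'Z_p].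
Proof.
rewrite inE; apply/andP; split; first by apply/subsetP=> x; rewrite inE.
by apply/morphicP=> x y _ _; rewrite !permE /sq_act mulrDr.
Qed.

Definition sq_aut s : [subg (Aut [set: 'Z_p])] := Subg (sq_perm_Aut s).

Lemma sq_autM :
  {in [set: 'Z_p.-1] &, {morph sq_aut : s s' / (s * s')%g >-> (s * s')%g}}.
Proof.
move=> s s' _ _; apply/val_inj/permP=> x /=; rewrite permM !permE /sq_act.
rewrite mulrA -exprD -mulnDr; congr (_ * x).
have n_gt1 : (1 < p.-1)%N by case: (p) p_gt2 => [|[]].
have E : nat_of_ord (s * s')%g = ((s + s') %% p.-1)%N.
  by congr (_ %% _)%N; exact: Zp_cast.
by rewrite E !(mulnC 2) exprM (prim_expr_mod t_prim) -exprM addnC.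
Qed.

(* phi_s(x) = t^(2s) x; well defined on Z_(p-1) because t^(p-1) = 1. *)
Definition sq_phi : Zaut_morphism p p.-1 := Morphism sq_autM.

Lemma sq_phiE s x : Zact sq_phi s x = t%:~R ^+ (2 * s) * x.
Proof. by rewrite /Zact /= permE. Qed.

End SquareAction.

Lemma prime_3mod4_gt2 p : prime p -> p = 3 %[mod 4] -> 2 < p.
Proof. by case: p => [|[|[|p]]]. Qed.

(* Main.v *)
(* Put q = (p - 1)/2.  For 0 <= a < pq and k = a %/ q the sequence is
     g_(2a) = (k, a),   g_(2a+1) = (- (k + 1), - (a + 1)),
   i.e. the zigzag 0, -1, 1, -2, 2, ... of the cyclic groups Z_(p-1) (in the
   second coordinate) and Z_(2p) reduced mod p (in the first one, where each
   entry is paired with one traversal of Z_(p-1)).  As t^(2q) = 1, the action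
   of a depends only on a mod q.  The second coordinate of the i-th quotient is
   (-1)^(i+1) (i + 1) mod 2q: it determines the parity of i = 2a or 2a + 1 and
   a mod q, hence the acting element, so that the first coordinate then
   determines k = a %/ q, hence a. *)
Require Import Defs.
From mathcomp Require Import all_boot all_order all_algebra all_fingroup.
From mathcomp Require Import all_solvable finfield zify.

Set Implicit Arguments.
Unset Strict Implicit.
Unset Printing Implicit Defensive.

Import GRing.Theory.

(** * Congruences, and general facts about the semidirect product *)

Lemma Zp_nat_eq (m a b : nat) : 1 < m ->
  (a%:R == b%:R :> 'Z_m)%R = (a == b %[mod m]).
Proof. by move=> m_gt1; rewrite -val_eqE /= !val_Zp_nat. Qed.

Lemma Zp_nat_eq0 (m a : nat) : 1 < m -> (a%:R == 0 :> 'Z_m)%R = (m %| a).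
Proof. by move=> m_gt1; rewrite -(mulr0n 1%R) Zp_nat_eq // mod0n. Qed.

Lemma card_Zsdprod (m n : nat) (phi : Zaut_morphism m n) :
  1 < m -> 1 < n -> #|{: Zsdprod phi}| = m * n.
Proof.
move=> m_gt1 n_gt1.
have bij : bijective (@Zsd_pair m n phi).
  by exists (@ZSdPair m n phi) => // -[].
by rewrite (bij_eq_card bij) card_prod !card_ord !Zp_cast.
Qed.

Lemma ZSdPair_inj (m n : nat) (phi : Zaut_morphism m n) r s r' s' :
  ZSdPair phi (r, s) = ZSdPair phi (r', s') -> r = r' /\ s = s'.
Proof. by case. Qed.

Lemma Zsdprod_divE (m n : nat) (phi : Zaut_morphism m n) (u v : Zsdprod phi) :
  (u^-1 * v)%g
  = ZSdPair phi (Zact phi (- u.2) (v.1 - u.1), v.2 - u.2)%R.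
Proof.
change (u^-1 * v)%g with (Zsdprod_mul (Zsdprod_inv u) v).
rewrite /Zsdprod_mul /Zsdprod_inv /= [(_ + v.2)%R]addrC; congr (ZSdPair _ (_, _)).
apply: (@addrI _ (Zact phi (- u.2)%R u.1)).
by rewrite addrA subrr add0r -ZactD addrC subrK.
Qed.

Lemma Zsdprod_abelian_act (m n : nat) (phi : Zaut_morphism m n) :
  abelian [set: Zsdprod phi] -> forall s x, Zact phi s x = x.
Proof.
move/centsP=> comm s x.
have /(congr1 (fun u : Zsdprod phi => u.1)) :=
  comm (ZSdPair phi (0, s))%R (in_setT _) (ZSdPair phi (x, 0))%R (in_setT _).
by rewrite /= add0r Zact0 addr0.
Qed.

Lemma Zact_inj (m n : nat) (phi : Zaut_morphism m n) s : injective (Zact phi s).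
Proof.
apply: (can_inj (g := Zact phi (- s)%R)) => x.
by rewrite -Zact_add addNr Zact0.
Qed.

Lemma eqn_modS (m a b : nat) : (a.+1 == b.+1 %[mod m]) = (a == b %[mod m]).
Proof. by rewrite -(addn1 a) -(addn1 b) eqn_modDr. Qed.

Lemma eqn_mod_double (q a b : nat) :
  (a.*2 == b.*2 %[mod q.*2]) = (a == b %[mod q]).
Proof. by rewrite -!mul2n -!muln_modr eqn_mul2l. Qed.

(** 2 is invertible modulo an odd number. This is what allows k to be read off from 2k modulo p. *)
Lemma eqn_mod_odd_double (m a b : nat) : odd m ->
  (a.*2 == b.*2 %[mod m]) = (a == b %[mod m]).
Proof.
move=> m_odd; wlog le_ba: a b / b <= a => [IH|].
  by have [/IH//|/ltnW/IH] := leqP b a; rewrite eq_sym [RHS]eq_sym.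
rewrite !eqn_mod_dvd ?leq_double // -doubleB -mul2n.
by rewrite Gauss_dvdr // coprimen2.
Qed.

Lemma divn_mod_inj (q a b : nat) : a %/ q = b %/ q -> a = b %[mod q] -> a = b.
Proof. by move=> Ed Em; rewrite (divn_eq a q) (divn_eq b q) Ed Em. Qed.

(** * The zigzag sequence and its quotients *)

Section Sequencing.
Variables (p : nat) (t : int).
Hypotheses (p_gt2 : 2 < p) (t_prim : primitive_root_mod p t) (p_odd : odd p).

Let G := Zsdprod (sq_phi p_gt2 t_prim).
Let q := p.-1./2.

Let pE : p = q.*2.+1.
Proof. rewrite /q; lia. Qed.

Let q_gt0 : 0 < q.
Proof. move: pE; lia. Qed.

Definition ddp_seq (i : nat) : G :=
  let a := i./2 in let k := a %/ q in
  ZSdPair _ (if odd i then (- k.+1%:R, - a.+1%:R) else (k%:R, a%:R))%R.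

Lemma ddp_seq_even a : ddp_seq a.*2 = ZSdPair _ ((a %/ q)%:R, a%:R)%R.
Proof. by rewrite /ddp_seq odd_double doubleK. Qed.

Lemma ddp_seq_odd a :
  ddp_seq a.*2.+1 = ZSdPair _ (- (a %/ q).+1%:R, - a.+1%:R)%R.
Proof. by rewrite /ddp_seq /= odd_double uphalf_double. Qed.

(** For indices of equal parity, the first coordinate gives [a %/ q] and the second gives a mod q.
    Opposite parities are excluded by comparing the size of a + b + 1 with its divisibility by p -
    1. *)
Lemma ddp_seq_inj i j : i < p * p.-1 -> j < p * p.-1 ->
  ddp_seq i = ddp_seq j -> i = j.
Proof.
have n_gt1 : 1 < p.-1 by lia.
have p_gt1 : 1 < p by lia.
have n2q : p.-1 = q * 2 by lia.
have quo_lt a : a.*2 < p * p.-1 -> a %/ q < p.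
  by move=> aN; rewrite ltn_divLR //; nia.
have modn_q a b : a = b %[mod p.-1] -> a = b %[mod q].
  by move=> E; rewrite -(@modn_dvdm p.-1 a q) ?E ?modn_dvdm // n2q dvdn_mulr.
have even_odd a b : a.*2 < p * p.-1 -> b.*2 < p * p.-1 ->
    ddp_seq a.*2 <> ddp_seq b.*2.+1.
  move=> /quo_lt ka /quo_lt kb; rewrite ddp_seq_even ddp_seq_odd.
  case/ZSdPair_inj=> /eqP; rewrite -addr_eq0 -natrD Zp_nat_eq0 // => k_dv.
  move=> /eqP; rewrite -addr_eq0 -natrD Zp_nat_eq0 // => s_dv.
  (* The left side is a multiple of p lying strictly between 0 and 2p. *)
  have kE : a %/ q + (b %/ q).+1 = p.
    case/dvdnP: k_dv ka kb; move: (a %/ q) (b %/ q) => k l.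
    by case=> [|[|c]]; rewrite ?mul1n ?mul0n ?mulSn; lia.
  have := ltn_pmod a q_gt0; have := ltn_pmod b q_gt0.
  have := divn_eq a q; have := divn_eq b q.
  move: kE (a %% q) (b %% q) => {k_dv ka kb}.
  move: (a %/ q) (b %/ q) => k l kE u v bE aE vq uq.
  have klE : k * q + l * q = q * p.-1 by nia.
  (* As k + l = p - 1, the quotients contribute a multiple of p - 1. The remainders leave u + v + 1,
     which is positive and at most 2q - 1 < p - 1, so p - 1 cannot divide the sum. *)
  have abE : a + b.+1 = (u + v).+1 + q * p.-1 by lia.
  move: s_dv; rewrite abE dvdn_addl ?dvdn_mull // => /dvdn_leq; lia.
have [a [b ->]] : exists a (b : bool), i = b + a.*2.
  by exists i./2, (odd i); rewrite odd_double_half.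
have [a' [b' ->]] : exists a (b : bool), j = b + a.*2.
  by exists j./2, (odd j); rewrite odd_double_half.
case: b b' => -[]; rewrite ?add1n ?add0n => aN aN'.
- rewrite !ddp_seq_odd => /ZSdPair_inj[/oppr_inj/eqP kE /oppr_inj/eqP sE].
  move: kE sE; rewrite !Zp_nat_eq // !eqn_modS => /eqP kE /eqP sE.
  congr (_.*2.+1); apply: (@divn_mod_inj q); last exact: modn_q.
  by move: kE; rewrite !modn_small ?quo_lt //; lia.
- by move/esym/even_odd; case; lia.
- by move/even_odd; case; lia.
- rewrite !ddp_seq_even => /ZSdPair_inj[/eqP kE /eqP sE].
  move: kE sE; rewrite !Zp_nat_eq // => /eqP kE /eqP sE.
  congr (_.*2); apply: (@divn_mod_inj q); last exact: modn_q.
  by move: kE; rewrite !modn_small ?quo_lt.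
Qed.

Let phi := sq_phi p_gt2 t_prim.

Let act_nat_mod a b x : a = b %[mod q] -> Zact phi a%:R%R x = Zact phi b%:R%R x.
Proof.
move=> ab; rewrite !sq_phiE; congr (_ * x)%R; apply/eqP.
have n_gt1 : 1 < p.-1 by lia.
have nE : p.-1 = 2 * q by lia.
rewrite (eq_prim_root_expr t_prim) !val_Zp_nat // nE -!muln_modr -nE.
by rewrite !modn_dvdm ?ab // nE dvdn_mull.
Qed.

Let act_opp_nat_mod a b x :
  a = b %[mod q] -> Zact phi (- a%:R)%R x = Zact phi (- b%:R)%R x.
Proof.
move=> ab; rewrite -[x in LHS](Zact0 phi) -(subrr (b%:R : 'Z_p.-1)%R).
by rewrite Zact_add -(act_nat_mod _ ab) -Zact_add addNr Zact0.
Qed.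

Lemma ddp_seq_div_even a :
  ((ddp_seq a.*2)^-1 * ddp_seq a.*2.+1)%g
  = ZSdPair _ (Zact phi (- a%:R) (- (a %/ q).*2.+1%:R), - a.*2.+1%:R)%R.
Proof.
rewrite Zsdprod_divE ddp_seq_even ddp_seq_odd /=.
by rewrite -!opprD -!natrD !addSn !addnn.
Qed.

Lemma ddp_seq_div_odd a :
  ((ddp_seq a.*2.+1)^-1 * ddp_seq a.+1.*2)%g
  = ZSdPair _ (Zact phi a.+1%:R (a.+1 %/ q + (a %/ q).+1)%:R, a.+1.*2%:R)%R.
Proof.
rewrite Zsdprod_divE ddp_seq_even ddp_seq_odd /=.
by rewrite !opprK -!natrD addnn.
Qed.

Lemma ddp_seq_div_inj i j : i < (p * p.-1).-1 -> j < (p * p.-1).-1 ->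
  ((ddp_seq i)^-1 * ddp_seq i.+1)%g = ((ddp_seq j)^-1 * ddp_seq j.+1)%g -> i = j.
Proof.
have n_gt1 : 1 < p.-1 by lia.
have p_gt1 : 1 < p by lia.
have n2q : p.-1 = q.*2 by lia.
have quo_lt a : a.*2 < (p * p.-1).-1 -> a %/ q < p.
  by move=> aN; rewrite ltn_divLR //; nia.
have even_odd a b : ((ddp_seq a.*2)^-1 * ddp_seq a.*2.+1)%g
    <> ((ddp_seq b.*2.+1)^-1 * ddp_seq b.+1.*2)%g.
  rewrite ddp_seq_div_even ddp_seq_div_odd => /ZSdPair_inj[_ /esym/eqP].
  (* Equality would make the even modulus 2q divide the odd number (2b + 2) + (2a + 1). *)
  rewrite -addr_eq0 -natrD Zp_nat_eq0 // n2q => /dvdnP[c].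
  by move/(congr1 odd); rewrite -doubleMr oddD /= !odd_double.
have [a [b ->]] : exists a (b : bool), i = b + a.*2.
  by exists i./2, (odd i); rewrite odd_double_half.
have [a' [b' ->]] : exists a (b : bool), j = b + a.*2.
  by exists j./2, (odd j); rewrite odd_double_half.
case: b b' => -[]; rewrite ?add1n ?add0n -?doubleS => aN aN'.
- rewrite !ddp_seq_div_odd => /ZSdPair_inj[rE /eqP].
  rewrite Zp_nat_eq // n2q eqn_mod_double => /eqP aE; move: rE.
  rewrite (act_nat_mod _ aE) => /Zact_inj/eqP; rewrite Zp_nat_eq //.
  (* The first coordinate, stripped of the action, is 2k + 1, plus 1 when q divides a + 1. That
     correction depends only on a mod q, so it cancels and 2k is left. *)
  have dvE : (q %| a.+1) = (q %| a'.+1) by rewrite /dvdn aE.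
  rewrite !divnS // dvE -!addnA !eqn_modDl !addnS !addnn eqn_modS.
  rewrite eqn_mod_odd_double // !modn_small ?quo_lt //; try lia.
  move/eqP=> kE; congr (_.*2.+1); apply: (@divn_mod_inj q) => //.
  by move/eqP: aE; rewrite eqn_modS => /eqP.
- by move/esym/even_odd.
- by move/even_odd.
- rewrite !ddp_seq_div_even => /ZSdPair_inj[rE /oppr_inj/eqP].
  rewrite Zp_nat_eq // n2q eqn_modS eqn_mod_double => /eqP aE; move: rE.
  rewrite (act_opp_nat_mod _ aE) => /Zact_inj/oppr_inj/eqP.
  rewrite Zp_nat_eq // eqn_modS eqn_mod_odd_double // !modn_small ?quo_lt //.
  by move/eqP=> kE; congr (_.*2); apply: (@divn_mod_inj q).
Qed.

Lemma sq_phi_DDP : DDP G.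
Proof.
have cG : #|{: G}| = p * p.-1 by rewrite card_Zsdprod //; lia.
set N := p * p.-1 in cG.
have N_gt0 : 0 < N by rewrite /N; nia.
exists (mkseq ddp_seq N).
have uG : uniq (mkseq ddp_seq N).
  rewrite map_inj_in_uniq ?iota_uniq // => i j; rewrite !mem_iota.
  by move=> /andP[_ iN] /andP[_ jN]; apply: ddp_seq_inj.
split.
- apply: uniq_perm => //; first exact: enum_uniq.
  have sG : {subset mkseq ddp_seq N <= enum {: G}} by move=> x _; rewrite mem_enum.
  by have [] := uniq_min_size uG sG; rewrite // size_mkseq -cardE cG.
- by rewrite nth_mkseq // /ddp_seq /= div0n.
- move=> i j ij; rewrite cG => jN.
  rewrite !nth_mkseq; try lia; move=> /ddp_seq_div_inj; lia.
Qed.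

End Sequencing.

(** * Primes congruent to 3 mod 4, primitive roots, and non-commutativity *)

(** Strong induction: if the least prime factor is not 3 mod 4, it must be 1 mod 4, and the smaller
    cofactor is again 3 mod 4. *)
Lemma prime_3mod4_factor m : m = 3 %[mod 4] ->
  exists r, [/\ prime r, r = 3 %[mod 4] & r %| m].
Proof.
elim/ltn_ind: m => m IH m3.
have m_gt1 : 1 < m by case: m m3 {IH} => [|[]].
have pr := pdiv_prime m_gt1; have dv := pdiv_dvd m.
have [r3|r3] := eqVneq (pdiv m %% 4) 3; first by exists (pdiv m).
have /dvdnP[m' mE] := dv.
have r_gt1 := prime_gt1 pr.
have m'3 : m' = 3 %[mod 4].
  move: m3 r3; rewrite {1}mE -modnMm.
  have := ltn_pmod m' (isT : 0 < 4); have := ltn_pmod (pdiv m) (isT : 0 < 4).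
  by case: (m' %% 4) => [|[|[|[|]]]] //; case: (pdiv m %% 4) => [|[|[|[|]]]].
have [|r [r_pr r_3 r_dv]] := IH m' _ m'3.
  by rewrite [ltnRHS]mE ltn_Pmulr //; case: m' m'3 {mE}.
by exists r; split; rewrite // mE dvdn_mulr.
Qed.

(** Euclid's argument with 4 m! - 1: a factor r <= m would divide both 4 m! and its predecessor. *)
Lemma prime_3mod4_above m : exists r, [&& prime r, r %% 4 == 3 & m < r].
Proof.
have f_gt0 := fact_gt0 m.
have [|r [r_pr r3 r_dv]] := @prime_3mod4_factor (m`! * 4).-1; first lia.
exists r; rewrite r_pr r3 /= ltnNge; apply/negP => r_le.
have r_dvf : r %| m`! * 4 by rewrite dvdn_mulr // dvdn_fact // prime_gt0.
move: r_dvf; rewrite -[m`! * 4]prednK ?muln_gt0 ?f_gt0 //.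
by rewrite -addn1 dvdn_addr // dvdn1; case: r r_pr {r3 r_dv r_le} => [|[]].
Qed.

Lemma primitive_root_exists p : prime p -> exists t, primitive_root_mod p t.
Proof.
move=> p_pr; have p_gt1 := prime_gt1 p_pr.
have nz_root : all p.-1.-unity_root%R [seq x <- enum 'F_p | x != 0%R].
  apply/allP => x; rewrite mem_filter => /andP[x0 _].
  rewrite unity_rootE -(inj_eq (mulfI x0)) mulr1 -exprS prednK ?prime_gt0 //.
  by have := expf_card x; rewrite card_Fp // => ->.
have sz : p.-1 <= size [seq x <- enum 'F_p | x != 0%R].
  rewrite -{1}(card_Fp p_pr) -(cardC1 (0%R : 'F_p)) cardE.
  apply: uniq_leq_size (enum_uniq _) _ => x; rewrite mem_enum inE => x0.
  by rewrite mem_filter x0 mem_enum.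
have := has_prim_root _ nz_root (filter_uniq _ (enum_uniq _)) sz.
case/(_ _)/hasP=> [|x _ x_prim]; first by case: p p_gt1 {p_pr nz_root sz} => [|[]].
(* ['F_p] is by definition ['Z_(pdiv p)]; retyping the root exposes [pdiv p], which can then be
   rewritten to p. *)
have [y y_prim] : exists y : 'Z_(pdiv p), (p.-1.-primitive_root y)%R by exists x.
rewrite (pdiv_id p_pr) in y y_prim *.
by exists (y : nat)%:Z%R; rewrite /primitive_root_mod -pmulrn natr_Zp.
Qed.

(** A trivial action would give t^2 = 1, whereas t has order p - 1 > 2. *)
Lemma sq_phi_nonabelian p t (p_gt2 : 2 < p) (t_prim : primitive_root_mod p t) :
  3 < p -> ~~ abelian [set: Zsdprod (sq_phi p_gt2 t_prim)].
Proof.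
move=> p_gt3; apply/negP => /Zsdprod_abelian_act/(_ 1 1)%R.
rewrite sq_phiE mulr1 => /eqP.
have n_gt1 : 1 < p.-1 by lia.
have -> : ((1 : 'Z_p.-1)%R : nat) = 1.
  by have := val_Zp_nat n_gt1 1; rewrite modn_small.
rewrite -(prim_order_dvd t_prim) => /dvdn_leq; lia.
Qed.

Theorem theorem17 :
  (forall (p : nat) (t : int) (p_prime : prime p) (p_mod4 : p = 3 %[mod 4])
          (t_prim : primitive_root_mod p t),
      DDP (Zsdprod (sq_phi (prime_3mod4_gt2 p_prime p_mod4) t_prim)))
  /\ (exists F : nat -> finGroupType,
        (forall k : nat, DDP (F k) /\ ~~ abelian [set: F k])
        /\ (forall k l : nat, k <> l -> ~~ ([set: F k] \isog [set: F l])%g)).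
Proof.
split=> [p t p_prime p_mod4 t_prim|].
  by apply: sq_phi_DDP; lia.
pose next m := sval (sigW (prime_3mod4_above m)).
have nextP m : [&& prime (next m), next m %% 4 == 3 & m < next m].
  exact: svalP (sigW (prime_3mod4_above m)).
(* Starting above 3 matters: for p = 3 the action is trivial and the group is abelian. *)
pose P k := next (iter k next 3).
have P_pr k : prime (P k) by case/and3P: (nextP (iter k next 3)).
have P_3 k : P k = 3 %[mod 4] by case/and3P: (nextP (iter k next 3)) => _ /eqP.
have P_lt k : P k < P k.+1 by case/and3P: (nextP (P k)).
have P_gt3 k : 3 < P k.
  by elim: k => [|k IH]; [case/and3P: (nextP 3) | apply: ltn_trans (P_lt k)].
pose T k := sigW (primitive_root_exists (P_pr k)).
pose F k : finGroupType :=
  Zsdprod (sq_phi (prime_3mod4_gt2 (P_pr k) (P_3 k)) (svalP (T k))).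
have FE k : #|[set: F k]| = P k * (P k).-1.
  by rewrite cardsT card_Zsdprod //; have := P_gt3 k; lia.
exists F; split=> [k|k l kl].
  split; first by apply: sq_phi_DDP; have := P_3 k; lia.
  exact: sq_phi_nonabelian.
(* The groups are told apart by their orders, which increase strictly with the prime. *)
have F_lt i j : i < j -> P i * (P i).-1 < P j * (P j).-1.
  move=> ij; have := homo_ltn ltn_trans P_lt ij.
  by have := P_gt3 i; nia.
apply/negP => /card_isog; rewrite !FE.
by have [/F_lt|/F_lt|//] := ltngtP k l; lia.
Qed.
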